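(* Let $n\ge 1$ be a natural number, and let $S_n$ be the semigroup with zero given by the presentation $$S_{n}=\left\langle a,b \;\middle|\; a^{n+1}=b^{2}=0,\ aba=0,\ ba^{i}b=0\ \text{ for all } i\ge 1\right\rangle .$$ Then: (1) $\omega(\Gamma(S_{n}))=2n-1$. (2) The null union $S_{n}\bullet S_{1}$ satisfies $\omega(\Gamma(S_{n}\bullet S_{1}))=2n$.
   Context: For a semigroup $S$, $Z(S)$ denotes its center, i.e. the set of elements commuting with every element of $S$. The commuting graph $\Gamma(S)$ is the simple graph with vertex set $S\setminus Z(S)$ in which two distinct vertices are joined by an edge if and only if they commute in $S$. $\omega(\Gamma)$ denotes the clique number of a graph $\Gamma$, i.e. the maximal size of a set of pairwise adjacent vertices. The presentation is taken in the category of semigroups with zero (a quotient of the free semigroup with a zero adjoined, without identity). For semigroups $S,T$ with zero (taken to be disjoint copies), the null union $S\bullet T$ is the set $S\cup T$ with the two zeros identified, with the products within $S$ and within $T$ as given, and with $st=ts=0$ for all $s\in S$ and $t\in T$. $S_1$ denotes the case $n=1$ of the family $S_n$. *)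

(* Defs.v *)
From HB Require Import structures.
From mathcomp Require Import all_boot.
From mathcomp Require Import boolp classical_sets functions cardinality.

Set Implicit Arguments.
Unset Strict Implicit.
Unset Printing Implicit Defensive.

Local Open Scope quotient_scope.
Local Open Scope classical_set_scope.
Local Open Scope card_scope.
Local Open Scope group_scope.

HB.mixin Record Semigroup_hasZero S of Semigroup S := {
  szero : S;
  mul_szero : forall x : S, szero * x = szero;
  mul_xszero : forall x : S, x * szero = szero
}.

#[short(type="semigroup0Type")]
HB.structure Definition Semigroup0 := {S of Semigroup_hasZero S & Semigroup S}.

(* [spow x k] is x^k for k >= 1; the library's [x ^+ k] requires a unit.
   The value at k = 0, here x, is junk. *)
Definition spow (S : semigroupType) (x : S) (k : nat) : S :=
  iter k.-1 (fun y => x * y) x.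

Definition center (S : semigroupType) : set S :=
  [set x | forall y, commute x y].
Arguments center : clear implicits.

Record sgraph := SGraph {
  vertex :> Type;
  adj : vertex -> vertex -> Prop;
  adj_sym : forall x y, adj x y -> adj y x;
  adj_irrefl : forall x, ~ adj x x
}.

Definition clique (G : sgraph) (A : set G) : Prop :=
  forall x y, A x -> A y -> x <> y -> adj x y.

(* [clique_number G k] says that the clique number of G is (finite and) k;
   cliques are not assumed to be finite. *)
Definition clique_number (G : sgraph) (k : nat) : Prop :=
  (exists2 A : set G, clique A & A #= `I_k) /\
  (forall A : set G, clique A -> A #<= `I_k).

Section CommutingGraph.
Variable S : semigroupType.

Definition noncentral : Type := ~` center S.

Definition cadj (x y : noncentral) : Prop := x <> y /\ commute (val x) (val y).

Lemma cadj_sym x y : cadj x y -> cadj y x.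
Proof. by case=> xy cxy; split; [exact/nesym | exact/commute_sym]. Qed.

Lemma cadj_irrefl x : ~ cadj x x.
Proof. by case. Qed.

Definition commuting_graph : sgraph := SGraph cadj_sym cadj_irrefl.

End CommutingGraph.

(* The free semigroup on X with a zero adjoined: [None] is the zero, and
   [Some (x, s)] is the nonempty word x :: s. *)
Definition free0 (X : choiceType) : Type := option (X * seq X).
HB.instance Definition _ (X : choiceType) := Choice.on (free0 X).

Section Free0.
Variable X : choiceType.

Definition free0_mul (u v : free0 X) : free0 X :=
  match u, v with
  | Some (x, s), Some (y, t) => Some (x, s ++ y :: t)
  | _, _ => None
  end.

Lemma free0_mulA : associative free0_mul.
Proof. by move=> [[x s]|] [[y t]|] [[z u]|] //=; rewrite -catA. Qed.

HB.instance Definition _ := isSemigroup.Build (free0 X) free0_mulA.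

Lemma free0_mul0x (u : free0 X) : (None : free0 X) * u = None.
Proof. by []. Qed.

Lemma free0_mulx0 (u : free0 X) : u * (None : free0 X) = None.
Proof. by case: u => [[]|]. Qed.

HB.instance Definition _ :=
  Semigroup_hasZero.Build (free0 X) free0_mul0x free0_mulx0.

Definition letter (x : X) : free0 X := Some (x, [::]).

End Free0.

(* The smallest congruence containing R. *)
Inductive cong (S : semigroupType) (R : S -> S -> Prop) : S -> S -> Prop :=
  | cong_base x y : R x y -> cong R x y
  | cong_refl x : cong R x x
  | cong_sym x y : cong R x y -> cong R y x
  | cong_trans y x z : cong R x y -> cong R y z -> cong R x z
  | cong_mul x x' y y' : cong R x x' -> cong R y y' -> cong R (x * y) (x' * y').

Section Quotient.
Variables (S : semigroup0Type) (R : S -> S -> Prop).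

Definition congb (x y : S) : bool := `[< cong R x y >].

Lemma congb_refl : reflexive congb.
Proof. by move=> x; apply/asboolP/cong_refl. Qed.

Lemma congb_sym : symmetric congb.
Proof. by move=> x y; apply/asboolP/asboolP => /cong_sym. Qed.

Lemma congb_trans : transitive congb.
Proof.
by move=> y x z /asboolP xy /asboolP yz; apply/asboolP/(cong_trans xy yz).
Qed.

Canonical congb_equiv := EquivRel congb congb_refl congb_sym congb_trans.

Definition squot : Type := {eq_quot congb_equiv}.
HB.instance Definition _ := Choice.on squot.
HB.instance Definition _ := EqQuotient.on squot.

Definition squot_mul (p q : squot) : squot := \pi_squot (repr p * repr q).

Lemma pi_squotP (x y : S) : \pi_squot x = \pi_squot y <-> cong R x y.
Proof. by split=> [/eqmodP/asboolP // | xy]; apply/eqmodP/asboolP. Qed.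

Lemma pi_squot_mul (x y : S) :
  squot_mul (\pi_squot x) (\pi_squot y) = \pi_squot (x * y).
Proof. by apply/pi_squotP/cong_mul; apply/pi_squotP; rewrite reprK. Qed.

Lemma squot_mulA : associative squot_mul.
Proof.
move=> p q r; elim/quotW: p => x; elim/quotW: q => y; elim/quotW: r => z.
by rewrite (pi_squot_mul y) !(pi_squot_mul x) pi_squot_mul mulgA.
Qed.

HB.instance Definition _ := isSemigroup.Build squot squot_mulA.

Definition squot_zero : squot := \pi_squot szero.

Lemma squot_mul0x (p : squot) : squot_zero * p = squot_zero.
Proof. by elim/quotW: p => x; rewrite [LHS]pi_squot_mul mul_szero. Qed.

Lemma squot_mulx0 (p : squot) : p * squot_zero = squot_zero.
Proof. by elim/quotW: p => x; rewrite [LHS]pi_squot_mul mul_xszero. Qed.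

HB.instance Definition _ :=
  Semigroup_hasZero.Build squot squot_mul0x squot_mulx0.

Lemma squot_mulE (x y : S) :
  (\pi_squot x : squot) * \pi_squot y = \pi_squot (x * y).
Proof. exact: pi_squot_mul. Qed.

End Quotient.

(* The two generators are encoded by the booleans. *)
Definition gen_a : free0 bool := letter true.
Definition gen_b : free0 bool := letter false.

Inductive Sn_rel (n : nat) : free0 bool -> free0 bool -> Prop :=
  | Sn_rel_a : Sn_rel n (spow gen_a n.+1) szero
  | Sn_rel_b : Sn_rel n (spow gen_b 2) szero
  | Sn_rel_aba : Sn_rel n (gen_a * gen_b * gen_a) szero
  | Sn_rel_bab i : (1 <= i)%N -> Sn_rel n (gen_b * spow gen_a i * gen_b) szero.

Definition Sn (n : nat) : semigroup0Type := squot (Sn_rel n).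

(* The null union of S and T: the disjoint union S + T with the two zeros
   identified. *)
Section NullUnion.
Variables S T : semigroup0Type.

Definition is_zero (x : S + T) : bool :=
  match x with inl s => s == szero | inr t => t == szero end.

Definition null_eq (x y : S + T) : bool := (x == y) || (is_zero x && is_zero y).

Lemma null_eq_refl : reflexive null_eq.
Proof. by move=> x; rewrite /null_eq eqxx. Qed.

Lemma null_eq_sym : symmetric null_eq.
Proof. by move=> x y; rewrite /null_eq eq_sym andbC. Qed.

Lemma null_eq_trans : transitive null_eq.
Proof.
move=> y x z /orP[/eqP-> //|/andP[x0 y0]] /orP[/eqP<-|/andP[_ z0]].
  by rewrite /null_eq x0 y0 orbT.
by rewrite /null_eq x0 z0 orbT.
Qed.

Canonical null_eq_equiv :=
  EquivRel null_eq null_eq_refl null_eq_sym null_eq_trans.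

Definition null_union : Type := {eq_quot null_eq_equiv}.
HB.instance Definition _ := Choice.on null_union.
HB.instance Definition _ := EqQuotient.on null_union.

Definition sum_mul (x y : S + T) : S + T :=
  match x, y with
  | inl s, inl s' => inl (s * s')
  | inr t, inr t' => inr (t * t')
  | _, _ => inl szero
  end.

Definition null_union_mul (p q : null_union) : null_union :=
  \pi_null_union (sum_mul (repr p) (repr q)).

Lemma sum_mulA : associative sum_mul.
Proof.
by move=> [x|x] [y|y] [z|z] //=; rewrite ?mulgA ?mul_szero ?mul_xszero.
Qed.

Lemma is_zero_mull x y : is_zero x -> is_zero (sum_mul x y).
Proof.
by case: x y => [x|x] [y|y] //= /eqP->; rewrite ?mul_szero eqxx.
Qed.

Lemma is_zero_mulr x y : is_zero y -> is_zero (sum_mul x y).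
Proof.
by case: x y => [x|x] [y|y] //= /eqP->; rewrite ?mul_xszero eqxx.
Qed.

Lemma pi_null_unionP (x y : S + T) :
  \pi_null_union x = \pi_null_union y <-> null_eq x y.
Proof. by split=> /eqmodP. Qed.

Lemma pi_null_union_mul (x y : S + T) :
  null_union_mul (\pi_null_union x) (\pi_null_union y)
  = \pi_null_union (sum_mul x y).
Proof.
have mulP x' y' : null_eq x' x -> null_eq y' y ->
    null_eq (sum_mul x' y') (sum_mul x y).
  move=> /orP[/eqP->|/andP[x0' x0]].
    move=> /orP[/eqP->|/andP[y0' y0]]; first exact: null_eq_refl.
    by rewrite /null_eq !is_zero_mulr ?orbT.
  by move=> _; rewrite /null_eq !is_zero_mull ?orbT.
by apply/pi_null_unionP/mulP; apply/pi_null_unionP; rewrite reprK.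
Qed.

Lemma null_union_mulA : associative null_union_mul.
Proof.
move=> p q r; elim/quotW: p => x; elim/quotW: q => y; elim/quotW: r => z.
by rewrite (pi_null_union_mul y) !(pi_null_union_mul x) pi_null_union_mul
  sum_mulA.
Qed.

HB.instance Definition _ := isSemigroup.Build null_union null_union_mulA.

Definition null_union_zero : null_union := \pi_null_union (inl szero).

Lemma null_union_mul0x (p : null_union) : null_union_zero * p = null_union_zero.
Proof.
elim/quotW: p => x; rewrite [LHS]pi_null_union_mul.
by apply/pi_null_unionP; rewrite /null_eq is_zero_mull /= eqxx ?orbT.
Qed.

Lemma null_union_mulx0 (p : null_union) : p * null_union_zero = null_union_zero.
Proof.
elim/quotW: p => x; rewrite [LHS]pi_null_union_mul.
by apply/pi_null_unionP; rewrite /null_eq is_zero_mulr /= eqxx ?orbT.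
Qed.

HB.instance Definition _ :=
  Semigroup_hasZero.Build null_union null_union_mul0x null_union_mulx0.

Lemma null_union_mulE (x y : S + T) :
  (\pi_null_union x : null_union) * \pi_null_union y
  = \pi_null_union (sum_mul x y).
Proof. exact: pi_null_union_mul. Qed.

End NullUnion.

(* Main.v *)
Require Import Defs.
From mathcomp Require Import all_boot.
From mathcomp Require Import boolp classical_sets functions cardinality.
From mathcomp Require Import zify.

(** Both values are certified in the same way: by a colouring of the noncentral
    elements in which commuting distinct elements get different colours, so
    that a clique has at most as many elements as there are colours, together
    with a clique that uses every colour once ([tight_colouring],
    [tight_colouring_clique_number]).

    The congruence defining S_n identifies two distinct words only if both
    vanish ([cong_Sn]), and the words that survive are a^i (1 <= i <= n),
    a^i b (i <= n) and b a^j (1 <= j <= n) ([normal_or_zero],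
    [normal_not_vanishing]). The elements a^n b and b a^n are central, since
    multiplying them by anything produces a second b or too many a's
    ([center_cl]). Two elements containing b always commute, because both
    products are 0; the noncentral ones b, ab, ..., a^(n-1) b,
    ba, ..., b a^(n-1) therefore form a clique of size 2n-1, and their colours
    0, ..., 2n-2 are assigned in this order. Each a^i takes the colour of
    a^(n-i) b, with which it does not commute, since a^i a^(n-i) b = a^n b is
    not 0 while the product in the other order is 0 or ends with a
    ([not_commute_a_ab]). No further colour is needed, and the powers of a get
    distinct ones.

    In a null union every element of one part commutes with every element of
    the other, and centrality can be tested inside each part. Placing the
    colours of the second part after those of the first, and joining the two
    cliques, gives a tight colouring whose size is the sum of the sizes
    ([null_union_tight_colouring]). For S_n and S_1 this sum is
    (2n - 1) + 1 = 2n. *)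

Set Implicit Arguments.
Unset Strict Implicit.
Unset Printing Implicit Defensive.

Local Open Scope quotient_scope.
Local Open Scope classical_set_scope.
Local Open Scope card_scope.
Local Open Scope group_scope.

(** * Clique numbers certified by colourings *)

(** Colours and clique members are given on the semigroup itself rather than on
    the type of vertices, so that they can be computed on representatives;
    [c] on central elements and [f] beyond [k] are arbitrary. That [f] has [k]
    distinct values follows from [family_colour]. *)
Record tight_colouring (S : semigroupType) (k : nat)
    (c : S -> nat) (f : nat -> S) : Prop := TightColouring {
  colour_lt : forall x, ~ center S x -> (c x < k)%N;
  colour_proper : forall x y, ~ center S x -> ~ center S y ->
    commute x y -> c x = c y -> x = y;
  family_noncentral : forall i, (i < k)%N -> ~ center S (f i);
  family_commute : forall i j, (i < k)%N -> (j < k)%N -> commute (f i) (f j);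
  family_colour : forall i, (i < k)%N -> c (f i) = i
}.

Lemma tight_colouring_clique_number (S : semigroupType) k c f :
  @tight_colouring S k c f -> clique_number (commuting_graph S) k.
Proof.
move=> [ltc propc ncf comf colf]; split.
  (* The colour is a bijection from this clique onto the set of colours. *)
  pose A : set (noncentral S) := [set v | exists2 i, (i < k)%N & val v = f i].
  exists A.
    move=> u v [i ik ui] [j jk vj] uv; split=> //.
    by rewrite ui vj; exact: comf.
  have Afun : set_fun A `I_k (fun v => c (val v)).
    by move=> v [i ik vi] /=; rewrite vi colf.
  have : set_bij A `I_k (fun v => c (val v)).
    split=> //.
      move=> u v /set_mem[i ik ui] /set_mem[j jk vj]; rewrite ui vj !colf // => ij.
      by apply: val_inj; rewrite ui vj ij.
    move=> i /= ik; have mi : f i \in ~` center S by rewrite inE; exact: ncf.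
    by exists (exist _ (f i) mi); [exists i | exact: colf].
  by move=> bijc; apply/card_set_bijP; exists (fun v => c (val v)).
move=> A clA.
have ncv (v : noncentral S) : ~ center S (val v).
  by case: v => x /= /set_mem.
apply/pcard_leP; apply/injfunPex; exists (fun v => c (val v)).
  by move=> v _; exact: ltc.
move=> u v /set_mem Au /set_mem Av cuv; apply: contrapT => uv.
have [_ com] := clA _ _ Au Av uv.
by apply: uv; apply: val_inj; exact: propc com cuv.
Qed.

(** * Null unions *)

Lemma center_szero (S : semigroup0Type) : center S szero.
Proof. by move=> x; rewrite /commute mul_szero mul_xszero. Qed.

Section NullUnion.
Variables S T : semigroup0Type.
Implicit Types (s : S) (t : T).

Definition null_inl s : null_union S T := \pi_(null_union S T) (inl s).
Definition null_inr t : null_union S T := \pi_(null_union S T) (inr t).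

Lemma null_inlM s s' : null_inl s * null_inl s' = null_inl (s * s').
Proof. by rewrite /null_inl null_union_mulE. Qed.

Lemma null_inrM t t' : null_inr t * null_inr t' = null_inr (t * t').
Proof. by rewrite /null_inr null_union_mulE. Qed.

Lemma null_inlr_commute s t : commute (null_inl s) (null_inr t).
Proof. by rewrite /commute /null_inl /null_inr !null_union_mulE. Qed.

Lemma null_inl_inj : injective null_inl.
Proof.
move=> s s' /pi_null_unionP /orP[/eqP[] // | /= /andP[/eqP-> /eqP->] //].
Qed.

Lemma null_inr_inj : injective null_inr.
Proof.
move=> s s' /pi_null_unionP /orP[/eqP[] // | /= /andP[/eqP-> /eqP->] //].
Qed.

Lemma null_inl_commute s s' :
  commute (null_inl s) (null_inl s') <-> commute s s'.
Proof.
rewrite /commute !null_inlM; split=> [/null_inl_inj // | -> //].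
Qed.

Lemma null_inr_commute t t' :
  commute (null_inr t) (null_inr t') <-> commute t t'.
Proof.
rewrite /commute !null_inrM; split=> [/null_inr_inj // | -> //].
Qed.

Variant null_union_spec : null_union S T -> Prop :=
  | NullInl s : null_union_spec (null_inl s)
  | NullInr t : null_union_spec (null_inr t).

Lemma null_unionP p : null_union_spec p.
Proof. by elim/quotW: p => -[s|t]; [exact: NullInl | exact: NullInr]. Qed.

Lemma center_null_inl s : center _ (null_inl s) <-> center S s.
Proof.
split=> [cs s' | cs p]; first exact/null_inl_commute/cs.
case: (null_unionP p) => [s'|t]; last exact: null_inlr_commute.
exact/null_inl_commute/cs.
Qed.

Lemma center_null_inr t : center _ (null_inr t) <-> center T t.
Proof.
split=> [ct t' | ct p]; first exact/null_inr_commute/ct.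
case: (null_unionP p) => [s|t']; first exact/commute_sym/null_inlr_commute.
exact/null_inr_commute/ct.
Qed.

(** Only the common zero has two representatives, and it is central, so
    computing with [repr] is harmless on noncentral elements. *)
Definition null_union_colour k (c : S -> nat) (d : T -> nat)
    (p : null_union S T) : nat :=
  match repr p with inl s => c s | inr t => k + d t end.

Lemma repr_null_inl s : ~ center S s -> repr (null_inl s) = inl s.
Proof.
move=> ncs; have /pi_null_unionP/orP[/eqP // | /andP[_ /= /eqP s0]] :
  \pi_(null_union S T) (repr (null_inl s)) = \pi_(null_union S T) (inl s).
  by rewrite reprK.
by case: ncs; rewrite s0; exact: center_szero.
Qed.

Lemma repr_null_inr t : ~ center T t -> repr (null_inr t) = inr t.
Proof.
move=> nct; have /pi_null_unionP/orP[/eqP // | /andP[_ /= /eqP t0]] :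
  \pi_(null_union S T) (repr (null_inr t)) = \pi_(null_union S T) (inr t).
  by rewrite reprK.
by case: nct; rewrite t0; exact: center_szero.
Qed.

(** Elements of different parts always commute, so they must get different
    colours; the shift by [k] ensures this, and the union of the two cliques is
    again a clique. *)
Lemma null_union_tight_colouring k l c d f g :
  @tight_colouring S k c f -> @tight_colouring T l d g ->
  tight_colouring (k + l) (null_union_colour k c d)
    (fun i => if (i < k)%N then null_inl (f i) else null_inr (g (i - k)%N)).
Proof.
move=> [ltc propc ncf comf colf] [ltd propd ncg comg colg].
have colourl s : ~ center S s -> null_union_colour k c d (null_inl s) = c s.
  by move=> ncs; rewrite /null_union_colour repr_null_inl.
have colourr t : ~ center T t ->
    null_union_colour k c d (null_inr t) = (k + d t)%N.
  by move=> nct; rewrite /null_union_colour repr_null_inr.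
have subP i : (i < k + l)%N -> (i < k)%N = false -> (i - k < l)%N by lia.
split.
- move=> p; case: (null_unionP p) => [s|t].
    by move/center_null_inl => ncs; rewrite colourl // ltn_addr ?ltc.
  by move/center_null_inr => nct; rewrite colourr // ltn_add2l ltd.
- move=> p q; case: (null_unionP p) => [s|t]; case: (null_unionP q) => [s'|t'].
  + move=> /center_null_inl ncs /center_null_inl ncs' /null_inl_commute com.
    by rewrite !colourl // => /(propc _ _ ncs ncs' com)->.
  + move=> /center_null_inl ncs /center_null_inr nct _.
    by rewrite colourl // colourr //; have := ltc _ ncs; lia.
  + move=> /center_null_inr nct /center_null_inl ncs _.
    by rewrite colourl // colourr //; have := ltc _ ncs; lia.
  + move=> /center_null_inr nct /center_null_inr nct' /null_inr_commute com.
    by rewrite !colourr // => /addnI /(propd _ _ nct nct' com)->.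
- move=> i ikl; case: ifP => ik; first by move/center_null_inl; exact: ncf.
  by move/center_null_inr; apply: ncg; exact: subP.
- move=> i j ikl jkl; case: ifP => ik; case: ifP => jk.
  + by apply/null_inl_commute; exact: comf.
  + exact: null_inlr_commute.
  + exact/commute_sym/null_inlr_commute.
  + by apply/null_inr_commute; apply: comg; exact: subP.
- move=> i ikl; case: ifP => ik; first by rewrite colourl ?colf //; exact: ncf.
  by rewrite colourr ?colg; [lia | exact: subP | apply: ncg; exact: subP].
Qed.

End NullUnion.

(** * Words and the congruence of S_n *)

(** The right-hand side, equality outside an ideal [I], is the Rees congruence
    of [I]; since it contains [R], it contains the smallest such congruence.
    This bounds the identifications made by a presentation whose relations
    all have the form w = 0. *)
Lemma cong_ideal (S : semigroupType) (R : S -> S -> Prop) (I : S -> Prop) :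
    (forall x y, I x -> I (x * y)) -> (forall x y, I y -> I (x * y)) ->
    (forall x y, R x y -> I x /\ I y) ->
  forall x y, cong R x y -> x = y \/ I x /\ I y.
Proof.
move=> Il Ir RI x y; elim=> {x y}.
- by move=> x y /RI; right.
- by left.
- by move=> x y _ [->|[]]; [left | right].
- by move=> y x z _ [->|[Ix Iy]] _ [<-|[Iy' Iz]]; auto.
- move=> x x' y y' _ [->|[Ix Ix']] _ [->|[Iy Iy']]; first by left.
  + by right; split; apply: Ir.
  + by right; split; apply: Il.
  + by right; split; apply: Il.
Qed.

(* In words, true is the letter a and false is the letter b. *)
Notation a_ i := (nseq i true).

Section Words.
Variable n : nat.
Implicit Types (w u v : seq bool).

(** The empty word, absent from the free semigroup, is sent to the zero: this
    makes [word] a bijection, but it is multiplicative only on nonempty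
    words. *)
Definition word w : free0 bool := if w is x :: s then Some (x, s) else None.
Definition letters (p : free0 bool) : seq bool :=
  if p is Some (x, s) then x :: s else [::].

Lemma wordK : cancel word letters. Proof. by case. Qed.
Lemma lettersK : cancel letters word. Proof. by case=> [[]|]. Qed.

Lemma word_cat u v : u != [::] -> v != [::] -> word (u ++ v) = word u * word v.
Proof. by case: u => [|x u] //; case: v. Qed.

Lemma spow_gen_a i : (0 < i)%N -> spow gen_a i = word (a_ i).
Proof.
by case: i => // i _; rewrite /spow /=; elim: i => //= i ->.
Qed.

(** An upper bound for the words that are 0 in S_n which is visibly an ideal
    containing the relators. It is phrased by counts and a scattered subword
    because these are monotone and easy to evaluate on normal words;
    that it is exact is [bad_cl0]. *)
Definition bad w : bool :=
  [|| (n < count_mem true w)%N, (1 < count_mem false w)%N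
    | subseq [:: true; false; true] w].

Lemma bad_catl u v : bad u -> bad (u ++ v).
Proof.
rewrite /bad !count_cat => /or3P[H|H|H]; apply/or3P.
- by constructor 1; exact: ltn_addr.
- by constructor 2; exact: ltn_addr.
- by constructor 3; apply: subseq_trans H (prefix_subseq _ _).
Qed.

Lemma bad_catr u v : bad v -> bad (u ++ v).
Proof.
rewrite /bad !count_cat => /or3P[H|H|H]; apply/or3P.
- by constructor 1; exact: ltn_addl.
- by constructor 2; exact: ltn_addl.
- by constructor 3; apply: subseq_trans H (suffix_subseq _ _).
Qed.

Definition bad_word (p : free0 bool) : Prop := p = None \/ bad (letters p).

Lemma cong_Sn p q :
  cong (Sn_rel n) p q -> p = q \/ bad_word p /\ bad_word q.
Proof.
apply: cong_ideal => {p q}.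
- move=> [[x s]|] [[y t]|] [// | /= Hb]; [right | by left..].
  exact: (@bad_catl (x :: s)).
- move=> [[x s]|] [[y t]|] [// | /= Hb]; [right | by left..].
  exact: (@bad_catr (x :: s)).
- move=> p q [||| i i0]; (split; [right | by left]).
  + by rewrite spow_gen_a // wordK /bad count_nseq /= mul1n ltnSn.
  + by rewrite /bad orbT.
  + by rewrite /bad !orbT.
  + rewrite spow_gen_a // -[gen_b]/(word [:: false]) -!word_cat ?wordK //;
      try by case: (i) i0.
    by rewrite /bad !count_cat /= addn1 ltnS leq_addr orbT.
Qed.

Definition cl w : Sn n := \pi_(squot (Sn_rel n)) (word w).

Lemma cl_cat u v : u != [::] -> v != [::] -> cl (u ++ v) = cl u * cl v.
Proof. by move=> u0 v0; rewrite /cl squot_mulE word_cat. Qed.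

Lemma clP x : exists w, x = cl w.
Proof. by elim/quotW: x => p; exists (letters p); rewrite /cl lettersK. Qed.

(** The nonzero elements of S_n have a unique representing word. *)
Lemma cl_eq u v :
  cl u = cl v -> u = v \/ (u = [::] \/ bad u) /\ (v = [::] \/ bad v).
Proof.
have word0 w : bad_word (word w) -> w = [::] \/ bad w.
  by move=> [|]; [case: w; left | rewrite wordK; right].
move=> /pi_squotP /cong_Sn [/(can_inj wordK)|[/word0 ? /word0 ?]];
  by [left | right].
Qed.

Lemma cl0 : cl [::] = szero. Proof. by []. Qed.

Lemma cl_infix0 u v w : v != [::] -> cl v = szero -> cl (u ++ v ++ w) = szero.
Proof.
move=> v0 clv0; have clvw : cl (v ++ w) = szero.
  case: (eqVneq w [::]) => [->|w0]; first by rewrite cats0.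
  by rewrite cl_cat // clv0 mul_szero.
case: (eqVneq u [::]) => [-> // | u0].
by rewrite cl_cat ?clvw ?mul_xszero //; case: (v) v0.
Qed.

Lemma cl_rel w : Sn_rel n (word w) szero -> cl w = szero.
Proof. by move=> rw; apply/pi_squotP/cong_base. Qed.

Lemma cl_rel_a : cl (a_ n.+1) = szero.
Proof. by apply: cl_rel; rewrite -spow_gen_a //; exact: Sn_rel_a. Qed.

Lemma cl_rel_b : cl [:: false; false] = szero.
Proof. by apply: cl_rel; exact: Sn_rel_b. Qed.

Lemma cl_rel_aba : cl [:: true; false; true] = szero.
Proof. by apply: cl_rel; exact: Sn_rel_aba. Qed.

Lemma cl_rel_bab i : cl (false :: a_ i ++ [:: false]) = szero.
Proof.
case: (posnP i) => [-> | i0]; first exact: cl_rel_b.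
apply: cl_rel; have := Sn_rel_bab n i0.
rewrite spow_gen_a // -[gen_b]/(word [:: false]) -!word_cat //;
  by case: (i) i0.
Qed.

(** * Normal forms *)

Variant normal : seq bool -> Prop :=
  | NormalA i of (0 < i <= n)%N : normal (a_ i)
  | NormalAB i of (i <= n)%N : normal (a_ i ++ [:: false])
  | NormalBA j of (0 < j <= n)%N : normal (false :: a_ j).

(** By induction on the word: putting one letter in front of a normal word gives
    a normal word or makes one of the relators appear as a factor. *)
Lemma normal_or_zero w : (0 < n)%N -> cl w = szero \/ normal w.
Proof.
move=> n0; elim: w => [|x w IH]; first by left.
case: (eqVneq w [::]) => [-> | w0].
  by right; case: x; [apply: (@NormalA 1) | apply: (@NormalAB 0)].
case: IH => [clw0 | ].
  by left; rewrite -[x :: w]/([:: x] ++ w) cl_cat // clw0 mul_xszero.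
case=> {w w0} [i /andP[i0 iLn] | i iLn | j /andP[j0 jLn]]; case: x.
- move: iLn; rewrite leq_eqVlt => /orP[/eqP-> | iLn]; first by left; exact: cl_rel_a.
  by right; apply: (@NormalA i.+1).
- by right; apply: NormalBA; rewrite i0.
- move: iLn; rewrite leq_eqVlt => /orP[/eqP-> | iLn].
    by left; exact: (@cl_infix0 [::] (a_ n.+1) [:: false] isT cl_rel_a).
  by right; apply: (@NormalAB i.+1).
- by left; exact: cl_rel_bab.
- left; case: j j0 jLn => // j _ _.
  exact: (@cl_infix0 [::] [:: true; false; true] (a_ j) isT cl_rel_aba).
- by left; exact: (@cl_infix0 [::] [:: false; false] (a_ j) isT cl_rel_b).
Qed.

Lemma normal_not_vanishing w : normal w -> w != [::] /\ ~~ bad w.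
Proof.
have noba i : subseq [:: false; true] (a_ i ++ [:: false]) = false.
  by elim: i.
have noaba i : subseq [:: true; false; true] (a_ i) = false.
  apply/negP => /mem_subseq /(_ false); rewrite !inE mem_nseq andbF.
  by move=> /(_ isT).
case=> {w} [i /andP[i0 iLn] | i iLn | j /andP[j0 jLn]];
  rewrite /bad /= ?count_cat ?count_nseq /= ?mul1n ?mul0n ?noaba;
  rewrite ?addn0 ?add0n -?leqNgt ?iLn ?jLn ?orbF -?leqNgt ?iLn ?jLn //.
- by case: i i0 {iLn}.
- split; first by case: i {iLn}.
  rewrite ltnNge iLn /=; case: i {iLn} => //= i; by rewrite noba.
Qed.

Lemma normal_cl_inj u v : normal u -> cl v = cl u -> v = u.
Proof.
move=> /normal_not_vanishing[u0 /negP ub] /cl_eq[// | [_ [u0'|//]]].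
by rewrite u0' in u0.
Qed.

Lemma letters_repr_cl w : normal w -> letters (repr (cl w)) = w.
Proof.
move=> nw; apply: (normal_cl_inj nw).
by rewrite /cl lettersK reprK.
Qed.

(** A bad word is not normal, so it is 0: among nonempty words, [bad] describes
    exactly those that vanish in S_n. *)
Lemma bad_cl0 w : (0 < n)%N -> bad w -> cl w = szero.
Proof.
move=> n0 wb; case: (normal_or_zero w n0) => // /normal_not_vanishing[_].
by rewrite wb.
Qed.

Lemma commute_cl_bad u v : (0 < n)%N -> u != [::] -> v != [::] ->
  bad (u ++ v) -> bad (v ++ u) -> commute (cl u) (cl v).
Proof. by move=> n0 u0 v0 uv vu; rewrite /commute -!cl_cat // !bad_cl0. Qed.

Lemma commute_cl_normal u v : u != [::] -> v != [::] ->
  normal (u ++ v) -> commute (cl u) (cl v) -> v ++ u = u ++ v.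
Proof.
by move=> u0 v0 uv; rewrite /commute -!cl_cat // => /esym /(normal_cl_inj uv).
Qed.

(** * Commutation in S_n *)

(** Any further letter, on either side, exceeds one of the two counts. *)
Lemma center_cl w : (0 < n)%N ->
  (n <= count_mem true w)%N -> (0 < count_mem false w)%N ->
  center (Sn n) (cl w).
Proof.
move=> n0 wa wb x; have [u ->] := clP x.
case: (eqVneq u [::]) => [-> | u0].
  by rewrite /commute cl0 mul_szero mul_xszero.
have over : (n < count_mem true w + count_mem true u)%N
         || (1 < count_mem false w + count_mem false u)%N.
  case: u u0 => [//|[] u] _; apply/orP; [left | right];
    rewrite /= add1n addnS ltnS.
    exact: leq_trans wa (leq_addr _ _).
  exact: leq_trans wb (leq_addr _ _).
apply: commute_cl_bad => //; first by case: (w) wb.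
  by rewrite /bad !count_cat orbA over.
by rewrite /bad !count_cat orbA ![(count_mem _ u + _)%N]addnC over.
Qed.

(** The normal words other than a^n b and b a^n. *)
Variant noncentral_normal : seq bool -> Prop :=
  | NoncentralA i of (0 < i <= n)%N : noncentral_normal (a_ i)
  | NoncentralAB i of (i < n)%N : noncentral_normal (a_ i ++ [:: false])
  | NoncentralBA j of (0 < j < n)%N : noncentral_normal (false :: a_ j).

Lemma noncentral_normal_normal w : noncentral_normal w -> normal w.
Proof.
by case=> [i iP | i iP | j jP]; constructor; lia.
Qed.

Lemma noncentral_clP x : (0 < n)%N -> ~ center (Sn n) x ->
  exists2 w, noncentral_normal w & x = cl w.
Proof.
move=> n0; have [w ->] := clP x => ncw.
case: (normal_or_zero w n0) => [w0 | nw].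
  by case: ncw; rewrite w0; exact: center_szero.
exists w => //; case: nw ncw => [i iP | i iP | j jP] ncw.
- exact: NoncentralA.
- apply: NoncentralAB; rewrite ltnNge; apply/negP => ni; apply: ncw.
  by apply: center_cl => //; rewrite !count_cat !count_nseq /=; lia.
- apply: NoncentralBA; case/andP: jP => -> _ /=; rewrite ltnNge.
  apply/negP => nj; apply: ncw.
  by apply: center_cl => //=; rewrite !count_nseq /=; lia.
Qed.

(** The product a^(i+j) b is nonzero, and the opposite product ends with a. *)
Lemma not_commute_a_ab i j : (0 < i)%N -> (i + j <= n)%N ->
  ~ commute (cl (a_ i)) (cl (a_ j ++ [:: false])).
Proof.
move=> i0 ijn /commute_cl_normal h.
have := h; rewrite catA -nseqD => /(_ _ _ (NormalAB ijn)) E.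
have {E} : (a_ j ++ [:: false]) ++ a_ i = a_ (i + j) ++ [:: false].
  by apply: E; [case: (i) i0 | case: (j)].
move/(congr1 (last true)); rewrite !last_cat /=.
by case: i i0 {ijn h} => // i _ /=; elim: i.
Qed.

(** The product b a^(j+1) is nonzero, and the opposite product starts with a. *)
Lemma not_commute_ba_a j : (j < n)%N ->
  ~ commute (cl (false :: a_ j)) (cl (a_ 1)).
Proof.
move=> jn /commute_cl_normal h; have {h} := h isT isT.
rewrite cat_cons -nseqD addn1.
by move=> h; have := h (NormalBA (j := j.+1) jn).
Qed.

(** * The colouring of S_n *)

(** The values are n-i on a^i, n-1+j on b a^j and i on a^i b. The test on the
    last letter separates the last two families, and puts b itself, of colour 0,
    in the family a^i b. *)
Definition word_colour w : nat :=
  if false \notin w then n - size w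
  else if last true w then n.-1 + (size w).-1 else (size w).-1.

Definition Sn_colour (x : Sn n) : nat := word_colour (letters (repr x)).

(** The noncentral normal words containing b, listed by colour. *)
Definition b_word k : seq bool :=
  if (k < n)%N then a_ k ++ [:: false] else false :: a_ (k - n).+1.

Lemma word_colourA i : word_colour (a_ i) = n - i.
Proof. by rewrite /word_colour mem_nseq andbF size_nseq. Qed.

Lemma word_colourAB i : word_colour (a_ i ++ [:: false]) = i.
Proof.
by rewrite /word_colour mem_cat mem_head orbT last_cat size_cat size_nseq addn1.
Qed.

Lemma word_colourBA j : (0 < j)%N -> word_colour (false :: a_ j) = n.-1 + j.
Proof.
case: j => // j _; rewrite /word_colour mem_head /= size_nseq.
by have -> : last true (a_ j) = true by elim: j.
Qed.

Lemma Sn_colour_cl w : normal w -> Sn_colour (cl w) = word_colour w.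
Proof. by move=> nw; rewrite /Sn_colour letters_repr_cl. Qed.

Lemma word_colour_lt w :
  noncentral_normal w -> (word_colour w < 2 * n - 1)%N.
Proof.
case=> [i iP | i iP | j /andP[j0 jn]];
  rewrite ?word_colourA ?word_colourAB ?word_colourBA //; lia.
Qed.

(** The only colours shared by two different families are those of a^i and
    a^j b with i + j = n, which do not commute by [not_commute_a_ab]. *)
Lemma word_colour_proper u v : noncentral_normal u -> noncentral_normal v ->
  commute (cl u) (cl v) -> word_colour u = word_colour v -> u = v.
Proof.
case=> [i iP | i iP | j /andP[j0 jn]]; case=> [i' iP' | i' iP' | j' /andP[j0' jn']];
  rewrite ?word_colourA ?word_colourAB ?word_colourBA // => com E.
- by congr (a_ _); lia.
- by case: (@not_commute_a_ab i i') => //; lia.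
- lia.
- by case: (@not_commute_a_ab i' i); [lia.. | exact: commute_sym].
- by rewrite E.
- lia.
- lia.
- lia.
- by congr (_ :: a_ _); lia.
Qed.

Lemma b_word_noncentral k : (k < 2 * n - 1)%N -> noncentral_normal (b_word k).
Proof. by rewrite /b_word => kn; case: ifP => kn'; constructor; lia. Qed.

Lemma Sn_tight_colouring : (0 < n)%N ->
  tight_colouring (2 * n - 1) Sn_colour (fun k => cl (b_word k)).
Proof.
move=> n0; have colE w : noncentral_normal w -> Sn_colour (cl w) = word_colour w.
  by move/noncentral_normal_normal/Sn_colour_cl.
split.
- by move=> x /(noncentral_clP n0)[w nw ->]; rewrite colE // word_colour_lt.
- move=> x y /(noncentral_clP n0)[u nu ->] /(noncentral_clP n0)[v nv ->] com.
  by rewrite !colE // => /(word_colour_proper nu nv com)->.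
(* The letter a is the element that these words do not commute with. *)
- move=> k kn nc; move: (nc (cl (a_ 1))); rewrite /b_word; case: ifP => kn'.
    by move/commute_sym; apply: not_commute_a_ab.
  by apply: not_commute_ba_a; lia.
(* Both products contain two b's. *)
- move=> i j _ _; have b0 k : b_word k != [::].
    by rewrite /b_word; case: ifP => // _; case: (k).
  have b1 k : (0 < count_mem false (b_word k))%N.
    by rewrite /b_word; case: ifP => // _; rewrite count_cat addn1.
  by apply: commute_cl_bad => //; rewrite /bad !count_cat;
    have := b1 i; have := b1 j; lia.
- move=> k kn; rewrite colE; last exact: b_word_noncentral.
  rewrite /b_word; case: ifP => kn'; first by rewrite word_colourAB.
  by rewrite word_colourBA //; lia.
Qed.

End Words.

Theorem proposition6 (n : nat) (hn : (1 <= n)%N) :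
  clique_number (commuting_graph (Sn n)) (2 * n - 1)%N /\
  clique_number (commuting_graph (null_union (Sn n) (Sn 1))) (2 * n)%N.
Proof.
have tn := Sn_tight_colouring hn; have t1 := @Sn_tight_colouring 1 isT.
split; first exact: tight_colouring_clique_number tn.
have -> : (2 * n = (2 * n - 1) + (2 * 1 - 1))%N by lia.
exact: tight_colouring_clique_number (null_union_tight_colouring tn t1).
Qed.
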